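(* Let $a>0$ and $K>0$ be rational numbers and $n\ge 1$ a natural number. None of the posets $$\mathcal{D}_{\mathbb{Q}}=[[0,a]_{(\mathbb{Q}]}\to \mathbf{I}[-K,K]^n],\quad \mathcal{U}_{\mathbb{Q}}=[[0,a]_{(\mathbb{Q}]}\to[-K,K]^{\downarrow}],\quad \mathcal{L}_{\mathbb{Q}}=[[0,a]_{(\mathbb{Q}]}\to[-K,K]^{\uparrow}]$$ is continuous (in the sense of domain theory).
   Context: $[0,a]_{(\mathbb{Q}]}$ is the interval $[0,a]$ with the topology inherited from the rational upper limit topology on $\mathbb{R}$, i.e. the topology on $\mathbb{R}$ with base $\{(p,q]: p,q\in\mathbb{Q}\}$. $\mathbf{I}[-K,K]^n$ is the poset of non-empty compact boxes $\prod_{i=1}^n[a_i,b_i]\subseteq[-K,K]^n$ ordered by reverse inclusion. $[-K,K]^{\uparrow}$ is the set $[-K,K]$ ordered by $x\sqsubseteq y\iff x\le y$, and $[-K,K]^{\downarrow}$ is the set $[-K,K]$ ordered by $x\sqsubseteq y\iff x\ge y$. For a topological space $X$ and a dcpo $D$, $[X\to D]$ is the poset of functions continuous from $X$ to $D$ with its Scott topology, ordered pointwise; it is a dcpo. A dcpo is continuous if it has a basis, i.e. a subset $B$ such that for every element $x$ the set $\{b\in B: b\ll x\}$ is directed with supremum $x$, where $\ll$ is the way-below relation. *)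

(* Defs.v *)
From HB Require Import structures.
From mathcomp Require Import all_boot all_order all_algebra.
From mathcomp Require Import all_classical all_reals topology.

Set Implicit Arguments.
Unset Strict Implicit.
Unset Printing Implicit Defensive.

Import Order.TTheory GRing.Theory Num.Theory.

Local Open Scope classical_set_scope.
Local Open Scope order_scope.

HB.instance Definition _ d (T : porderType d) (A : set T) :=
  [SubChoice_isSubPOrder of {x : T | x \in A} by <: with d].

Section domain_theory.
Context d (T : porderType d).
Implicit Types (x y s : T) (A B U : set T).

Definition directed A :=
  A !=set0 /\ forall x y, A x -> A y -> exists2 z, A z & x <= z /\ y <= z.

Definition way_below x y := forall A s,
  directed A -> supremums A s -> y <= s -> exists2 z, A z & x <= z.

Definition domain_basis B := forall x,
  let Bx := [set b | B b /\ way_below b x] in directed Bx /\ supremums Bx x.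

(* Directed completeness is not part of this predicate. On a dcpo it is the
   usual notion of continuity, and keeping completeness out prevents its
   negation from holding merely because some directed supremum is missing. *)
Definition continuous_poset := exists B, domain_basis B.

Definition scott_open U :=
  (forall x y, U x -> x <= y -> U y) /\
  (forall A s, directed A -> supremums A s -> U s -> A `&` U !=set0).

Lemma scott_openT : scott_open setT.
Proof. by split=> // A s [[x Ax] _] _ _; exists x. Qed.

Lemma scott_openI : setI_closed scott_open.
Proof.
move=> U V [Uup Uin] [Vup Vin]; split=> [x y [Ux Vx] xy|A s Adir As [Us Vs]].
  by split; [exact: Uup xy | exact: Vup xy].
have [[x [Ax Ux]] [y [Ay Vy]]] := (Uin A s Adir As Us, Vin A s Adir As Vs).
have [z Az [xz yz]] := Adir.2 x y Ax Ay.
by exists z; split=> //; split; [exact: Uup xz | exact: Vup yz].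
Qed.

Lemma scott_open_bigU (I : Type) (f : I -> set T) :
  (forall i, scott_open (f i)) -> scott_open (\bigcup_i f i).
Proof.
move=> fo; split=> [x y [i _ fix_] xy|A s Adir As [i _ fis]].
  by exists i => //; exact: (fo i).1 xy.
by have [x [Ax fix_]] := (fo i).2 A s Adir As fis; exists x; split=> //; exists i.
Qed.

End domain_theory.

Arguments continuous_poset {d} T.

Definition scott d (T : porderType d) : Type := T.

HB.instance Definition _ d (T : porderType d) := Order.POrder.on (scott T).
HB.instance Definition _ d (T : porderType d) :=
  isOpenTopological.Build (scott T)
    (@scott_openT d T) (@scott_openI d T) (@scott_open_bigU d T).

Definition scott_fun (X : topologicalType) d (T : porderType d) : Type :=
  continuousType X (scott T).

Section pointwise_order.
Context (X : topologicalType) d (T : porderType d).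

HB.instance Definition _ := Choice.on (scott_fun X T).

Definition scott_fun_le (f g : scott_fun X T) : bool :=
  `[< forall x : X, (f : continuousType X (scott T)) x
                    <= (g : continuousType X (scott T)) x >].

Lemma scott_fun_le_refl : reflexive scott_fun_le.
Proof. by move=> f; apply/asboolP => x. Qed.

Lemma scott_fun_le_anti : antisymmetric scott_fun_le.
Proof.
move=> f g /andP[/asboolP fg /asboolP gf]; apply/continuousEP => x.
by apply/le_anti/andP; split; [exact: fg | exact: gf].
Qed.

Lemma scott_fun_le_trans : transitive scott_fun_le.
Proof.
move=> g f h /asboolP fg /asboolP gh; apply/asboolP => x.
exact: le_trans (fg x) (gh x).
Qed.

HB.instance Definition _ := Order.Le_isPOrder.Build d (scott_fun X T)
  scott_fun_le_refl scott_fun_le_anti scott_fun_le_trans.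

End pointwise_order.

Local Open Scope ring_scope.

Definition rat_upper (R : realType) : Type := R.

Section rational_upper_limit_topology.
Context (R : realType).

HB.instance Definition _ := Choice.on (rat_upper R).

Definition rat_upper_base (pq : rat * rat) : set (rat_upper R) :=
  [set x : R | ratr pq.1 < x <= ratr pq.2].

Lemma rat_upper_base_cover : \bigcup_(pq in setT) rat_upper_base pq = setT.
Proof.
apply/seteqP; split=> // x _.
have [|p] := @rat_in_itvoo R (x - 1) x; first by rewrite ltrBlDr ltrDl.
have [|q] := @rat_in_itvoo R x (x + 1); first by rewrite ltrDl.
rewrite !in_itv /= => /andP[xq _] /andP[_ px].
by exists (p, q) => //=; rewrite /rat_upper_base /= px ltW.
Qed.

Lemma rat_upper_base_join (i j : rat * rat) (t : rat_upper R) :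
    setT i -> setT j -> rat_upper_base i t -> rat_upper_base j t ->
  exists k, [/\ setT k, rat_upper_base k t &
    rat_upper_base k `<=` rat_upper_base i `&` rat_upper_base j].
Proof.
case: i j => [p q] [p' q'] _ _ /andP[/= pt tq] /andP[/= pt' tq'].
exists (Num.max p p', Num.min q q'); split=> //.
  apply/andP; split=> /=.
  - by case: (leP p p').
  - by case: (leP q q').
move=> x /andP[/= px xq]; split; apply/andP; split=> /=.
- by apply: le_lt_trans px; rewrite ler_rat le_max lexx.
- by apply: le_trans xq _; rewrite ler_rat ge_min lexx.
- by apply: le_lt_trans px; rewrite ler_rat le_max lexx orbT.
- by apply: le_trans xq _; rewrite ler_rat ge_min lexx orbT.
Qed.

HB.instance Definition _ := isBaseTopological.Build (rat_upper R)
  rat_upper_base_cover rat_upper_base_join.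

End rational_upper_limit_topology.

Definition rat_upper_seg (R : realType) (a : rat) : set (rat_upper R) :=
  [set x : R | 0 <= x <= ratr a].

Section codomains.
Context (R : realType) (K : rat).

Definition seg : set R := [set x | - ratr K <= x <= ratr K].

Definition seg_up : porderType _ := set_type seg.
Definition seg_down : porderType _ := (set_type seg)^d.

Definition box n (a b : 'rV[R]_n) : set 'rV[R]_n :=
  [set x | forall i, a 0 i <= x 0 i <= b 0 i].

Definition cube n : set 'rV[R]_n := [set x | forall i, seg (x 0 i)].

Definition boxes n : set (set 'rV[R]_n) :=
  [set B | [/\ exists a b, B = box a b, B !=set0 & B `<=` @cube n]].

(* The order on [set_type (boxes n)] is inclusion; its dual is the
   information order. *)
Definition box_poset n : porderType _ := (set_type (@boxes n))^d.

End codomains.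

Arguments seg_up : clear implicits.
Arguments seg_down : clear implicits.
Arguments box_poset : clear implicits.
Arguments rat_upper_seg : clear implicits.

(* Main.v *)
(* Let [e] be a non-bottom value and [b] way below the constant function [e].
   If [b] is not bottom at some [x > 0], it is not bottom on a basic
   neighbourhood [(p0, x]] of [x]. The functions equal to bottom on the clopen
   set [(p0, r]] and to [e] elsewhere increase to the constant [e] as [r]
   decreases to [p0], so [b] lies below one of them; yet [b r] is not bottom.
   Hence everything way below the constant [e] is bottom on [(0, a]], and all
   these functions have the upper bound that is bottom on [(0, a]] and [e] at
   [0]; this one is continuous because [0] is an isolated point. *)
Require Import Defs.
From HB Require Import structures.
From mathcomp Require Import all_boot all_order all_algebra.
From mathcomp Require Import all_classical all_reals topology.

Set Implicit Arguments.
Unset Strict Implicit.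
Unset Printing Implicit Defensive.

Import Order.TTheory GRing.Theory Num.Theory.

Local Open Scope ring_scope.
Local Open Scope classical_set_scope.

(** Each point has [U] or its complement as a neighbourhood, and the function is constant on
    both. *)
Lemma continuous_if_clopen (X Y : topologicalType) (U : set X) (u v : Y) :
  clopen U -> continuous (fun x => if x \in U then u else v).
Proof.
move=> [Uo Uc] x A /nbhs_singleton; rewrite nbhs_simpl /=.
have [/set_mem Ux Au|/negP xU Av] := ifPn; rewrite /nbhs /=.
  by apply: filterS (open_nbhs_nbhs (conj Uo Ux)) => y Uy /=; rewrite mem_set.
have Cx : (~` U) x by move=> /mem_set.
apply: filterS (open_nbhs_nbhs (conj (closed_openC Uc) Cx)) => y Uy /=.
by rewrite memNset.
Qed.

Section scott.
Context d (T : porderType d).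

(** If every member of [A] were [bot], then [bot] would be an upper bound of [A], forcing the
    supremum to be [bot]. *)
Lemma scott_open_neq_bot (bot : T) : (forall y, (bot <= y)%O) ->
  scott_open [set y : T | y != bot].
Proof.
move=> botP; split=> [x y /= xb xy|A s _ [_ sA] /= sb].
  by apply: contraNneq xb => yb; apply/eqP/le_anti; rewrite botP -yb xy.
apply: contrapT => A0; move/negP: sb; apply.
apply/eqP/le_anti; rewrite botP andbT; apply: sA => x Ax.
by rewrite (_ : x = bot) //; apply: contrapT => /eqP xb; apply: A0; exists x.
Qed.

Lemma way_below_le (x y : T) : way_below x y -> (x <= y)%O.
Proof.
move=> xy; have [||z -> //] := xy [set y] y _ _ (lexx y).
  by split=> [|_ _ -> ->]; exists y.
by rewrite supremums1.
Qed.

Context (X : topologicalType).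

Lemma scott_fun_leP (f g : scott_fun X T) :
  (f <= g)%O <-> forall x, ((Continuous.sort f x : T) <= Continuous.sort g x)%O.
Proof. by split=> [/asboolP|h] //; apply/asboolP. Qed.

Definition clopen_step (U : set X) (cU : clopen U) (u v : T) : scott_fun X T :=
  mkcts (@continuous_if_clopen X (scott T) U u v cU).

Lemma clopen_stepT (U : set X) (cU : clopen U) (u v : T) x :
  U x -> Continuous.sort (clopen_step cU u v) x = u.
Proof. by move=> Ux; rewrite /= /mkcts mem_set. Qed.

Lemma clopen_stepF (U : set X) (cU : clopen U) (u v : T) x :
  ~ U x -> Continuous.sort (clopen_step cU u v) x = v.
Proof. by move=> Ux; rewrite /= /mkcts memNset. Qed.

End scott.

Section rat_upper.
Context (R : realType).

Lemma open_rat_upper_base pq : open (@rat_upper_base R pq).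
Proof. by exists [set pq] => //; rewrite bigcup_set1. Qed.

Lemma nbhs_rat_upper (x : rat_upper R) (A : set (rat_upper R)) :
  nbhs x A -> exists2 pq, rat_upper_base pq x & @rat_upper_base R pq `<=` A.
Proof.
rewrite nbhsE => -[B [[D _ <-] [pq Dpq pqx]] BA].
by exists pq => // y pqy; apply: BA; exists pq.
Qed.

(** With [pq] = $(p,q)$, a point $x\le p$ outside $(p,q]$ has a neighbourhood $(r,p]$, and a point
    $x>q$ has $(q,r]$; both miss $(p,q]$. *)
Lemma clopen_rat_upper_base pq : clopen (@rat_upper_base R pq).
Proof.
split; first exact: open_rat_upper_base.
rewrite -openC openE => x /= /negP.
rewrite negb_and -leNgt -ltNge => /orP[xp|qx].
- have [|r] := @rat_in_itvoo R (x - 1) x; first by rewrite ltrBlDr ltrDl.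
  rewrite in_itv /= => /andP[_ rx].
  have rpx : rat_upper_base (r, pq.1) x by rewrite /rat_upper_base /= rx.
  apply: filterS (open_nbhs_nbhs (conj (open_rat_upper_base _) rpx)).
  by move=> y /andP[_ /= yp] /andP[/=]; rewrite ltNge yp.
- have [|r] := @rat_in_itvoo R x (x + 1); first by rewrite ltrDl.
  rewrite in_itv /= => /andP[xr _].
  have qrx : rat_upper_base (pq.2, r) x by rewrite /rat_upper_base /= qx ltW.
  apply: filterS (open_nbhs_nbhs (conj (open_rat_upper_base _) qrx)).
  by move=> y /andP[/= qy _] /andP[_ /=]; rewrite leNgt qy.
Qed.

Context (a : rat).
Let X : topologicalType := rat_upper_seg R a.

Definition seg_base pq : set X := set_val @^-1` @rat_upper_base R pq.

Lemma clopen_seg_base pq : clopen (seg_base pq).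
Proof.
apply: preimage_clopen (clopen_rat_upper_base pq) _.
exact: initial_continuous.
Qed.

Lemma nbhs_seg_base (x : X) (A : set X) :
  nbhs x A -> exists2 pq, seg_base pq x & seg_base pq `<=` A.
Proof.
rewrite nbhsE => -[_ [[B Bo <-] Bx] BA].
have [pq pqx pqB] := nbhs_rat_upper (open_nbhs_nbhs (conj Bo Bx)).
by exists pq => // y /pqB; exact: BA.
Qed.

Context d (T : porderType d) (bot e : T)
  (botP : forall y, (bot <= y)%O).

Let cste : scott_fun X T := mkcts (@cst_continuous X (scott T) e).
Let carve p r : scott_fun X T := clopen_step (clopen_seg_base (p, r)) bot e.

Lemma way_below_cst_bot (b : scott_fun X T) (x : X) :
  way_below b cste -> 0 < (val x : R) -> Continuous.sort b x = bot.
Proof.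
move=> b_e x_gt0; apply: contrapT => /eqP bx.
have Uo : open ([set y | y != bot] : set (scott T)) := scott_open_neq_bot botP.
have /nbhs_seg_base[[p q] /andP[/= px xq] pq_neq] :=
  @cts_fun _ _ b x _ (open_nbhs_nbhs (conj Uo bx)).
(* Any rational $r>p_0$ exceeds $p$, so it can stay in the neighbourhood $(p,q]$, and is positive,
   so it can stay in $[0,a]$. *)
set p0 := Num.max p 0.
have p0x : ratr p0 < val x :> R.
  by rewrite /p0; case: (leP p 0) => _; rewrite ?rmorph0.
pose A := [set carve p0 r | r in [set r : rat | p0 < r /\ ratr r < (val x : R)]].
have between (y : R) : ratr p0 < y -> y <= val x ->
    exists r : rat, [/\ p0 < r, ratr r < (val x : R) & ratr r < y].
  move=> p0y yx; have [r] := rat_in_itvoo p0y.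
  rewrite in_itv /= => /andP[p0r ry]; exists r; split=> //.
    by rewrite -(ltr_rat R).
  exact: lt_le_trans yx.
(* Shrinking $(p_0,r]$ raises the function, so the smaller of two cut points gives a common upper
   bound and [A] is directed. *)
have carveN r s : r <= s -> (carve p0 s <= carve p0 r)%O.
  move=> rs; apply/scott_fun_leP => y.
  have [p0sy|p0sy] := pselect (seg_base (p0, s) y).
    by rewrite [X in (X <= _)%O]clopen_stepT.
  rewrite [X in (X <= _)%O]clopen_stepF// clopen_stepF//.
  move=> /andP[p0y yr]; apply: p0sy; apply/andP; split=> //=.
  by apply: le_trans yr _; rewrite ler_rat.
have [||_ [r [p0r rx] <-] /scott_fun_leP b_r] := b_e A cste _ _ (lexx _).
- split.
    by have [r [p0r rx _]] := between _ p0x (lexx _); exists (carve p0 r), r.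
  move=> _ _ [r [p0r rx] <-] [s [p0s sx] <-].
  exists (carve p0 (Num.min r s)).
    by exists (Num.min r s) => //; case: (leP r s).
  by split; apply: carveN; rewrite ge_min lexx ?orbT.
- split=> [_ [r _ <-]|g gA].
    apply/scott_fun_leP => y.
    have [p0ry|p0ry] := pselect (seg_base (p0, r) y).
      by rewrite [X in (X <= _)%O]clopen_stepT.
    by rewrite [X in (X <= _)%O]clopen_stepF.
  apply/scott_fun_leP => y.
  (* Where $y\notin(p_0,r]$ the carved function takes the value [e], so an upper bound [g] of [A] is
     at least [e] at [y]. *)
  suff [r [p0r rx Nry]] : exists r : rat,
      [/\ p0 < r, ratr r < (val x : R) & ~ seg_base (p0, r) y].
    have /gA/scott_fun_leP/(_ y) : A (carve p0 r) by exists r.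
    by rewrite [X in (X <= _)%O]clopen_stepF.
  have [yp0|p0y] := leP (val y : R) (ratr p0).
    have [r [p0r rx _]] := between _ p0x (lexx _).
    by exists r; split=> // /andP[/=]; rewrite ltNge yp0.
  (* The minimum respects the bound by [x] in [between]; $r<y$ puts [y] outside $(p_0,r]$. *)
  have [||r [p0r rx]] := between (Num.min (val x : R) (val y)).
  - by rewrite lt_min p0x p0y.
  - by rewrite ge_min lexx.
  rewrite lt_min => /andP[_ ry].
  by exists r; split=> // /andP[_ /=]; rewrite leNgt ry.
have r_gt0 : 0 < r by apply: le_lt_trans p0r; rewrite le_max lexx orbT.
have rX : (ratr r : rat_upper R) \in rat_upper_seg R a.
  have /set_mem/andP[_ xa] := valP x; apply/mem_set/andP; split.
    by rewrite ler0q ltW.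
  exact: le_trans (ltW rx) xa.
pose y : X := SigSub rX.
(* The contradiction is at the point $r$: it lies in $(p,q]$, where [b] avoids [bot], and in the
   right-closed $(p_0,r]$, where the carved function is [bot]. *)
have /eqP : Continuous.sort b y != bot.
  apply: pq_neq; apply/andP; split=> /=.
    by rewrite ltr_rat; apply: le_lt_trans p0r; rewrite le_max lexx.
  exact: le_trans (ltW rx) xq.
apply; apply/le_anti; rewrite botP andbT.
by have := b_r y; rewrite clopen_stepT//; apply/andP; rewrite /= ltr_rat lexx.
Qed.

Lemma not_continuous_scott_fun :
  0 < a -> e != bot -> ~ continuous_poset (scott_fun X T).
Proof.
move=> a_gt0 e_bot [B /(_ cste) [_ [_ cste_min]]].
have aX : (ratr a : rat_upper R) \in rat_upper_seg R a.
  by apply/mem_set/andP; rewrite ler0q ltW.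
(* [carve 0 a] bounds everything way below [cste], hence also their supremum [cste]; at the point
   $a$ this reads [e <= bot]. *)
have /scott_fun_leP/(_ (SigSub aX)) : (cste <= carve 0 a)%O.
  apply: cste_min => b [_ b_e]; apply/scott_fun_leP => x.
  have [x_gt0|x_le0] := ltP 0 (val x : R).
    by rewrite (way_below_cst_bot b_e).
  rewrite clopen_stepF; last by move=> /andP[/=]; rewrite rmorph0 ltNge x_le0.
  by have /scott_fun_leP := way_below_le b_e; apply.
rewrite clopen_stepT; last by apply/andP; rewrite /= rmorph0 ltr0q.
by move=> e_le; move/eqP: e_bot; apply; apply/le_anti; rewrite botP andbT.
Qed.

End rat_upper.

Lemma mem_seg_oppK (R : realType) (K : rat) : 0 < K -> - ratr K \in @seg R K.
Proof. by move=> K0; apply/mem_set; rewrite /seg /= lexx ge0_cp ?ler0q ?ltW. Qed.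

Lemma mem_seg_K (R : realType) (K : rat) : 0 < K -> ratr K \in @seg R K.
Proof. by move=> K0; apply/mem_set; rewrite /seg /= lexx ge0_cp ?ler0q ?ltW. Qed.

Theorem corollary4p7 (R : realType) (a K : rat) (n : nat)
    (a_gt0 : 0 < a) (K_gt0 : 0 < K) (n_ge1 : (1 <= n)%N) :
  [/\ ~ continuous_poset (scott_fun (rat_upper_seg R a) (box_poset R K n)),
      ~ continuous_poset (scott_fun (rat_upper_seg R a) (seg_down R K)) &
      ~ continuous_poset (scott_fun (rat_upper_seg R a) (seg_up R K))].
Proof.
have NKK : - ratr K != ratr K :> R.
  by rewrite lt_eqF// gt0_cp ?ltr0q.
split.
(* Under reverse inclusion the whole cube is bottom; the degenerate box $\{0\}$ serves as [e]. *)
- have cubeP : @cube R K n \in @boxes R K n.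
    apply/mem_set; split=> //.
      by exists (const_mx (- ratr K)), (const_mx (ratr K)); apply/seteqP;
        split=> x xK i; have := xK i; rewrite !mxE.
    by exists 0 => i; rewrite mxE /seg /= oppr_le0 !ler0q ltW.
  have zeroP : [set 0 : 'rV[R]_n] \in @boxes R K n.
    apply/mem_set; split; last 2 first.
    + by exists 0.
    + by move=> _ -> i; rewrite mxE /seg /= oppr_le0 !ler0q ltW.
    exists 0, 0; apply/seteqP; split=> [x -> i|x x0]; first by rewrite mxE lexx.
    by apply/rowP => i; have := x0 i; rewrite mxE => /le_anti.
  apply: (@not_continuous_scott_fun R a _ (box_poset R K n)
    (SigSub cubeP) (SigSub zeroP)) => //.
    move=> [B BP]; rewrite leEdual subsetEset.
    by have /set_mem[_ _ BK] := BP; exact: BK.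
  apply/eqP => /(congr1 val) /= /seteqP[_ cube0].
  (* The corner $(K,\dots,K)$ would be $0$; as $n\ge1$, its first coordinate gives $K=0$. *)
  have : (const_mx (ratr K) : 'rV[R]_n) = 0.
    by apply: cube0 => i; rewrite mxE; exact/set_mem/mem_seg_K.
  move=> /rowP/(_ (Ordinal n_ge1)); rewrite !mxE => /eqP.
  by rewrite fmorph_eq0 gt_eqF.
(* In the dual order $K$ is bottom and $-K$ serves as [e]; the roles are exchanged for [seg_up]. *)
- apply: (@not_continuous_scott_fun R a _ (seg_down R K)
    (SigSub (mem_seg_K R K_gt0)) (SigSub (mem_seg_oppK R K_gt0))) => //.
  by move=> [x xP]; have /set_mem/andP[] := xP.
- apply: (@not_continuous_scott_fun R a _ (seg_up R K)
    (SigSub (mem_seg_oppK R K_gt0)) (SigSub (mem_seg_K R K_gt0))) => //.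
    by move=> [x xP]; have /set_mem/andP[] := xP.
  by rewrite eq_sym.
Qed.
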